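(* Let $\mathcal{D}$ denote the set of data $(A,b)\in\mathbb{R}^{m\times n}\times\mathbb{R}^m$ for which each M-stationary point of the sparse recovery problem $\mathrm{SR}(A,b)$ is nondegenerate. Then $\mathcal{D}$ is open and dense in $\mathbb{R}^{m\times n}\times\mathbb{R}^m$.
   Context: Fix integers $m,n$ and $s\in\{0,1,\ldots,n-1\}$ with $s\le m$ (standing assumption). For $x\in\mathbb{R}^n$, $\|x\|_0$ is the number of non-zero entries of $x$, and $\mathbb{R}^{n,s}=\{x\in\mathbb{R}^n : \|x\|_0\le s\}$. For $(A,b)\in\mathbb{R}^{m\times n}\times\mathbb{R}^m$, the sparse recovery problem $\mathrm{SR}(A,b)$ is to minimize $f(x)=\frac12\|Ax-b\|_2^2$ subject to $x\in\mathbb{R}^{n,s}$. For $x\in\mathbb{R}^{n,s}$ put $I_0(x)=\{i : x_i=0\}$ and $I_1(x)=\{j : x_j\neq 0\}$. For an index set $I\subset\{1,\ldots,n\}$, $A_I$ is the submatrix of $A$ formed by the columns with index in $I$, $A_I^T$ is its transpose, and $x_I$ is the subvector of $x$ with entries indexed by $I$ (terms with empty index set are zero, conditions on an empty index set are vacuous). A point $\bar x\in\mathbb{R}^{n,s}$ is called M-stationary for $\mathrm{SR}(A,b)$ if $A_{I_1(\bar x)}^TA_{I_1(\bar x)}\bar x_{I_1(\bar x)}-A_{I_1(\bar x)}^Tb=0$. An M-stationary point $\bar x$ is called nondegenerate if both of the following hold: (ND1) if $\|\bar x\|_0<s$, then all entries of the vector $A_{I_0(\bar x)}^TA_{I_1(\bar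 x)}\bar x_{I_1(\bar x)}-A_{I_0(\bar x)}^Tb$ are non-zero; (ND2) $\mathrm{rank}(A_{I_1(\bar x)})=\|\bar x\|_0$. *)

(* Defs.v *)
From mathcomp Require Import all_boot all_order all_algebra.
From mathcomp Require Import all_classical all_reals all_analysis.

Set Implicit Arguments.
Unset Strict Implicit.
Unset Printing Implicit Defensive.

Import GRing.Theory.
Local Open Scope ring_scope.

(* Subvectors x_I and column submatrices A_I enumerate I in increasing order;
   for I = set0 they have zero rows, resp. zero columns, so that terms over an
   empty index set are 0 and conditions over it are vacuous. *)
Definition subvec (R : realType) (n : nat) (x : 'cV[R]_n) (I : {set 'I_n}) :
  'cV[R]_#|I| := rowsub (fun k : 'I_#|I| => enum_val k) x.

Definition subcols (R : realType) (m n : nat) (A : 'M[R]_(m, n))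
  (I : {set 'I_n}) : 'M[R]_(m, #|I|) :=
  colsub (fun k : 'I_#|I| => enum_val k) A.

Definition zero_idx (R : realType) (n : nat) (x : 'cV[R]_n) : {set 'I_n} :=
  [set i | x i ord0 == 0].

Definition supp_idx (R : realType) (n : nat) (x : 'cV[R]_n) : {set 'I_n} :=
  [set j | x j ord0 != 0].

Definition norm0 (R : realType) (n : nat) (x : 'cV[R]_n) : nat :=
  #|supp_idx x|.

(* The vector A_I^T A_J x_J - A_I^T b with J the support of x: the entries
   indexed by I of the gradient at x of the objective y |-> ||A y - b||^2 / 2. *)
Definition grad_on (R : realType) (m n : nat) (A : 'M[R]_(m, n))
  (b : 'cV[R]_m) (x : 'cV[R]_n) (I : {set 'I_n}) : 'cV[R]_#|I| :=
  (subcols A I)^T *m subcols A (supp_idx x) *m subvec x (supp_idx x)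
  - (subcols A I)^T *m b.

Definition M_stationary (R : realType) (m n s : nat) (A : 'M[R]_(m, n))
  (b : 'cV[R]_m) (x : 'cV[R]_n) : Prop :=
  (norm0 x <= s)%N /\ grad_on A b x (supp_idx x) = 0.

Definition ND1 (R : realType) (m n s : nat) (A : 'M[R]_(m, n))
  (b : 'cV[R]_m) (x : 'cV[R]_n) : Prop :=
  (norm0 x < s)%N ->
  forall k : 'I_#|zero_idx x|, grad_on A b x (zero_idx x) k ord0 != 0.

Definition ND2 (R : realType) (m n : nat) (A : 'M[R]_(m, n))
  (x : 'cV[R]_n) : Prop :=
  \rank (subcols A (supp_idx x)) = norm0 x.

Definition nondegenerate (R : realType) (m n s : nat) (A : 'M[R]_(m, n))
  (b : 'cV[R]_m) (x : 'cV[R]_n) : Prop :=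
  ND1 s A b x /\ ND2 A x.

Definition nondegenerate_data (R : realType) (m n s : nat) :
  set ('M[R]_(m, n) * 'cV[R]_m) :=
  [set Ab | forall x : 'cV[R]_n,
     M_stationary s Ab.1 Ab.2 x -> nondegenerate s Ab.1 Ab.2 x]%classic.

(* Main.v *)
Require Import Defs.
From mathcomp Require Import perm.
From mathcomp Require Import all_boot all_order all_algebra.
From mathcomp Require Import all_classical all_reals all_analysis.

Import numFieldNormedType.Exports.

Set Implicit Arguments.
Unset Strict Implicit.
Unset Printing Implicit Defensive.

Import Order.TTheory GRing.Theory Num.Theory.
Local Open Scope ring_scope.

(** The set of nondegenerate data is cut out by finitely many polynomial
    inequations, none of which is void.

    Call a least-squares problem full when each solution y of its normal
    equations B^T B y = B^T b has only nonzero entries ([ls_full]).  The key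
    observation ([nondegenerate_dataP]) is that (A, b) is nondegenerate if and
    only if the problem for the columns A_J is full for every index set J with
    at most s elements.
    - Suppose that all these problems are full, and let x be M-stationary with
      support J.  If ND1 failed at an index i outside J, then x would solve the
      normal equations for J together with i, a set still of size at most s,
      with a zero entry at i.  ND2 holds because fullness forces the Gram
      matrix B^T B to be invertible ([ls_full_det]): a solution exists over the
      reals ([normal_eq_solvable]), and it could be moved along a kernel vector
      until one of its entries vanishes.
    - Conversely, a solution for J with a zero entry, extended by zero, is
      M-stationary with fewer than s nonzero entries, and its gradient vanishes
      at that entry, against ND1.

    By Cramer's rule fullness says that the polynomial vector
    adj (B^T B) B^T b has no zero entry ([ls_fullP]), so that degeneracy of the
    Gram matrix needs no separate condition.  Each such inequation defines an
    open set by continuity.  It defines a dense set because along every line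
    the entry is a univariate polynomial in the parameter
    ([cramer_ls_line]), which has finitely many roots unless it vanishes on the
    whole line, and because some data with orthonormal columns A_J, available
    since s <= m, make it nonzero ([cramer_ls_witness]).  Finite intersections
    of open dense sets are open and dense ([open_dense_forall]). *)

(** * Least-squares problems whose solutions have no zero entry *)

Lemma gram_eq0 (R : realDomainType) (m : nat) (u : 'rV[R]_m) :
  u *m u^T = 0 -> u = 0.
Proof.
move=> /matrixP /(_ ord0 ord0); rewrite !mxE => /eqP.
rewrite psumr_eq0 => [/allP h|j _]; last by rewrite mxE -expr2 sqr_ge0.
apply/rowP => j; rewrite mxE; have := h j (mem_index_enum j).
by rewrite mxE -expr2 sqrf_eq0 => /eqP.
Qed.

(** B^T B and B^T have the same rank, because a vector of the row space of B^T
    that is killed by B is orthogonal to itself. *)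
Lemma normal_eq_solvable (R : realFieldType) (m r : nat) (B : 'M[R]_(m, r))
  (b : 'cV[R]_m) : exists y : 'cV[R]_r, B^T *m B *m y = B^T *m b.
Proof.
have rkG : \rank (B^T *m B) = \rank B^T.
  have := mxrank_mul_ker B^T B; suff -> : (B^T :&: kermx B)%MS = 0.
    by rewrite mxrank0 addn0.
  apply/eqP; rewrite -submx0; apply/rV_subP => u.
  rewrite sub_capmx => /andP[/submxP[w uE] /sub_kermxP uB].
  rewrite (@gram_eq0 _ _ u) ?sub0mx //.
  by rewrite {2}uE trmx_mul trmxK mulmxA uB mul0mx.
have /submxP[z zE] : (b^T *m B <= B^T *m B)%MS.
  apply: submx_trans (submxMl _ _) _.
  by rewrite -(mxrank_leqif_sup (submxMl _ _)) rkG mxrank_tr.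
exists z^T; apply: trmx_inj.
by rewrite !trmx_mul !trmxK zE.
Qed.

Definition ls_full (R : realFieldType) (m r : nat) (B : 'M[R]_(m, r))
    (b : 'cV[R]_m) : Prop :=
  forall y : 'cV[R]_r, B^T *m B *m y = B^T *m b -> forall k, y k ord0 != 0.

(** Adding to a solution a suitable multiple of a kernel vector of B^T B gives a
    solution that vanishes at a prescribed entry where the kernel vector does
    not. *)
Lemma ls_full_det (R : realFieldType) (m r : nat) (B : 'M[R]_(m, r))
  (b : 'cV[R]_m) : ls_full B b -> \det (B^T *m B) != 0.
Proof.
move=> full; apply/negP => /det0P[v v0 vG].
have Gv : B^T *m B *m v^T = 0.
  by apply: trmx_inj; rewrite !trmx_mul !trmxK trmx0.
have [j vj] : exists j, v ord0 j != 0 by apply/rV0Pn.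
have [y yE] := normal_eq_solvable B b.
have := full (y - (y j ord0 / v ord0 j) *: v^T) _ j.
rewrite mulmxBr -scalemxAr Gv scaler0 subr0 => /(_ yE).
by rewrite !mxE divfK // subrr eqxx.
Qed.

(** Up to the factor det (B^T B), the least-squares solution given by Cramer's
    rule; unlike that solution it is polynomial in the data.  It is defined over
    any commutative ring because it is also evaluated on matrices of univariate
    polynomials. *)
Definition cramer_ls (R : comPzRingType) (m r : nat) (B : 'M[R]_(m, r))
  (b : 'cV[R]_m) : 'cV[R]_r := \adj (B^T *m B) *m (B^T *m b).

Lemma cramer_lsE (R : comPzRingType) (m r : nat) (B : 'M[R]_(m, r))
  (b : 'cV[R]_m) (y : 'cV[R]_r) : B^T *m B *m y = B^T *m b ->
  cramer_ls B b = \det (B^T *m B) *: y.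
Proof.
by move=> yE; rewrite /cramer_ls -yE mulmxA mul_adj_mx mul_scalar_mx.
Qed.

(** When B^T B is singular, the Cramer vector is zero, so the inequations on the
    right exclude that case as well. *)
Lemma ls_fullP (R : realFieldType) (m r : nat) (B : 'M[R]_(m, r))
  (b : 'cV[R]_m) :
  ls_full B b <-> forall k, cramer_ls B b k ord0 != 0.
Proof.
split=> [full k | cr0 y yE k].
  have [y yE] := normal_eq_solvable B b.
  by rewrite (cramer_lsE yE) mxE mulf_neq0 ?(ls_full_det full) ?full.
by have := cr0 k; rewrite (cramer_lsE yE) mxE mulf_eq0 => /norP[].
Qed.

(** * Nondegeneracy as fullness on all small supports *)

Lemma subcols_subvec (R : realType) (m n : nat) (A : 'M[R]_(m, n))
  (x : 'cV[R]_n) (J : {set 'I_n}) :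
  supp_idx x \subset J -> subcols A J *m subvec x J = A *m x.
Proof.
move=> sJ; apply/matrixP => i k; rewrite !mxE.
rewrite (bigID (fun j => j \in J)) /= [X in _ + X]big1 ?addr0 => [|j jJ];
  last first.
  have : j \notin supp_idx x by apply: contra jJ => /(fintype.subsetP sJ).
  by rewrite inE negbK (ord1 k) => /eqP ->; rewrite mulr0.
rewrite (big_enum_val (fun j => A i j * x j k)) /=.
by apply: eq_bigr => j _; rewrite !mxE.
Qed.

Definition zero_ext (R : realType) (n : nat) (J : {set 'I_n})
  (y : 'cV[R]_#|J|) : 'cV[R]_n := subcols 1%:M J *m y.

Lemma zero_ext_enum_val (R : realType) (n : nat) (J : {set 'I_n})
  (y : 'cV[R]_#|J|) (k : 'I_#|J|) :
  zero_ext y (enum_val k) ord0 = y k ord0.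
Proof.
rewrite !mxE (bigD1 k) //= !mxE eqxx mul1r big1 ?addr0 // => l lk.
by rewrite !mxE (inj_eq enum_val_inj) eq_sym (negbTE lk) mul0r.
Qed.

Lemma supp_zero_ext (R : realType) (n : nat) (J : {set 'I_n})
  (y : 'cV[R]_#|J|) : supp_idx (zero_ext y) \subset J.
Proof.
apply/fintype.subsetP => i; rewrite inE; apply: contraR => iJ.
rewrite mxE big1 // => k _; rewrite !mxE.
case: eqP => [iE|_]; last by rewrite mul0r.
by rewrite iE enum_valP in iJ.
Qed.

Lemma mulmx_zero_ext (R : realType) (m n : nat) (A : 'M[R]_(m, n))
  (J : {set 'I_n}) (y : 'cV[R]_#|J|) : A *m zero_ext y = subcols A J *m y.
Proof. by rewrite mulmxA mulmx_colsub mulmx1. Qed.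

(** The support of x disappears from the formula: the entries of the
    gradient A^T (A x - b) can be compared across different index sets. *)
Lemma grad_onE (R : realType) (m n : nat) (A : 'M[R]_(m, n)) (b : 'cV[R]_m)
  (x : 'cV[R]_n) (I : {set 'I_n}) :
  grad_on A b x I = subvec (A^T *m (A *m x - b)) I.
Proof.
rewrite /grad_on -mulmxA subcols_subvec // -mulmxBr /subcols trmx_mxsub.
by rewrite mul_rowsub_mx.
Qed.

Lemma grad_on_entries (R : realType) (m n : nat) (A : 'M[R]_(m, n))
  (b : 'cV[R]_m) (x : 'cV[R]_n) (I : {set 'I_n}) (P : R -> Prop) :
  (forall k, P (grad_on A b x I k ord0)) <->
  (forall i, i \in I -> P ((A^T *m (A *m x - b)) i ord0)).
Proof.
rewrite grad_onE; set g := _ *m _.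
split=> [h i iI|h k]; last by rewrite mxE; exact/h/enum_valP.
by have := h (enum_rank_in iI i); rewrite mxE enum_rankK_in.
Qed.

Lemma grad_on_eq0 (R : realType) (m n : nat) (A : 'M[R]_(m, n))
  (b : 'cV[R]_m) (x : 'cV[R]_n) (I : {set 'I_n}) :
  grad_on A b x I = 0 <->
  forall i, i \in I -> (A^T *m (A *m x - b)) i ord0 = 0.
Proof.
rewrite -(grad_on_entries _ _ _ _ (fun t => t = 0)).
split=> [-> k|h]; first by rewrite mxE.
by apply/colP => k; rewrite h mxE.
Qed.

Lemma normal_eq_supp (R : realType) (m n : nat) (A : 'M[R]_(m, n))
  (b : 'cV[R]_m) (x : 'cV[R]_n) (J : {set 'I_n}) : supp_idx x \subset J ->
  (subcols A J)^T *m subcols A J *m subvec x J = (subcols A J)^T *m b <->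
  forall i, i \in J -> (A^T *m (A *m x - b)) i ord0 = 0.
Proof.
move=> sJ; rewrite -grad_on_eq0 grad_onE -mulmxA subcols_subvec //.
rewrite /subcols trmx_mxsub /subvec -mul_rowsub_mx mulmxBr.
by split=> [->|/eqP]; rewrite ?subrr // subr_eq0 => /eqP.
Qed.

(** A violation of ND1 at x, at an index i off the support, is the same thing as
    a solution with zero entry at i for the support enlarged by i; this is why
    ranging over all J with at most s elements captures the gradient condition
    that holds only for fewer than s nonzero entries. *)
Lemma nondegenerate_dataP (R : realType) (m n s : nat) (A : 'M[R]_(m, n))
  (b : 'cV[R]_m) :
  nondegenerate_data s (A, b) <->
  forall J : {set 'I_n}, (#|J| <= s)%N -> ls_full (subcols A J) b.
Proof.
split=> [nd J Js y yE k | full x [xs /grad_on_eq0 gx]].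
  (* the zero extension of a solution with a zero entry at k would be an
     M-stationary point that violates ND1 at enum_val k *)
  apply/negP => /eqP yk0; pose x := zero_ext y.
  have sxJ : supp_idx x \subset J by apply: supp_zero_ext.
  have xy : subvec x J = y.
    by apply/colP => l; rewrite mxE zero_ext_enum_val.
  have gJ := (normal_eq_supp A b sxJ).1; rewrite xy in gJ.
  have {}gJ := gJ yE.
  have xk : enum_val k \notin supp_idx x.
    by rewrite inE negbK zero_ext_enum_val yk0.
  have lt_s : (norm0 x < s)%N.
    apply: leq_trans Js; apply/proper_card/properP; split=> //.
    by exists (enum_val k) => //; exact: enum_valP.
  have [|nd1 _] := nd x.
    split; first exact: ltnW.
    by apply/grad_on_eq0 => i /(fintype.subsetP sxJ); exact: gJ.
  have /(grad_on_entries _ _ _ _ (fun t => t != 0)) := nd1 lt_s.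
  move=> /(_ (enum_val k)); rewrite inE zero_ext_enum_val yk0.
  by rewrite gJ ?enum_valP // eqxx => /(_ isT).
split; last first.
  rewrite /ND2; apply/eqP; rewrite eqn_leq rank_leq_col /=.
  have := ls_full_det (full _ xs); rewrite -unitfE -unitmxE -row_free_unit.
  by move=> /eqP rkG; rewrite /norm0 -[leqLHS]rkG; exact: mxrankM_maxr.
move=> xlts; apply/(grad_on_entries _ _ _ _ (fun t => t != 0)) => i.
rewrite inE => xi0; apply/negP => /eqP gi0.
pose J := i |: supp_idx x.
have iJ : i \in J by rewrite setU11.
have Js : (#|J| <= s)%N.
  by rewrite cardsU1 inE negbK xi0 add1n.
have := full J Js (subvec x J) _ (enum_rank_in iJ i).
rewrite mxE enum_rankK_in // (eqP xi0) eqxx => h; suff: false by []; apply: h.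
apply/normal_eq_supp; first exact: finset.subsetUr.
by move=> j; rewrite !inE => /orP[/eqP->//|jx]; apply: gx; rewrite inE.
Qed.

(** * Continuity of the Cramer vector *)

Definition coord_cont (T : topologicalType) (R : numFieldType) (m n : nat)
    (M : T -> 'M[R]_(m, n)) : Prop :=
  forall i j, continuous (fun z => M z i j).

Lemma continuous_sumr (T : topologicalType) (R : numFieldType) (I : Type)
  (r : seq I) (P : pred I) (F : I -> T -> R) :
  (forall i, P i -> continuous (F i)) ->
  continuous (fun z => \sum_(i <- r | P i) F i z).
Proof. by apply: continuous_big; exact: add_continuous. Qed.

Lemma continuous_prodr (T : topologicalType) (R : numFieldType) (I : Type)
  (r : seq I) (P : pred I) (F : I -> T -> R) :
  (forall i, P i -> continuous (F i)) ->
  continuous (fun z => \prod_(i <- r | P i) F i z).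
Proof. by apply: continuous_big; exact: mul_continuous. Qed.

Lemma coord_cont_mulmx (T : topologicalType) (R : numFieldType) (m n p : nat)
  (M : T -> 'M[R]_(m, n)) (N : T -> 'M[R]_(n, p)) :
  coord_cont M -> coord_cont N -> coord_cont (fun z => M z *m N z).
Proof.
move=> cM cN i k; under eq_fun do rewrite mxE.
apply: continuous_sumr => j _ z.
by apply: continuousM; [exact: cM|exact: cN].
Qed.

Lemma coord_cont_trmx (T : topologicalType) (R : numFieldType) (m n : nat)
  (M : T -> 'M[R]_(m, n)) : coord_cont M -> coord_cont (fun z => (M z)^T).
Proof. by move=> cM i j; under eq_fun do rewrite mxE; exact: cM. Qed.

Lemma coord_cont_mxsub (T : topologicalType) (R : numFieldType) (m n p q : nat)
  (f : 'I_p -> 'I_m) (g : 'I_q -> 'I_n) (M : T -> 'M[R]_(m, n)) :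
  coord_cont M -> coord_cont (fun z => mxsub f g (M z)).
Proof. by move=> cM i j; under eq_fun do rewrite mxE; exact: cM. Qed.

Lemma continuous_det (T : topologicalType) (R : numFieldType) (n : nat)
  (M : T -> 'M[R]_n) : coord_cont M -> continuous (fun z => \det (M z)).
Proof.
move=> cM.
have : continuous (fun z => \sum_(s : 'S_n) (-1) ^+ s * \prod_i M z i (s i)).
  apply: continuous_sumr => s _ z.
  apply: (@continuousM _ _ (cst ((-1) ^+ s))); first exact: cst_continuous.
  by apply: continuous_prodr => i _; exact: cM.
by [].
Qed.

Lemma coord_cont_adj (T : topologicalType) (R : numFieldType) (n : nat)
  (M : T -> 'M[R]_n) : coord_cont M -> coord_cont (fun z => \adj (M z)).
Proof.
move=> cM i j.
have cdet : continuous (fun z => \det (row' j (col' i (M z)))).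
  apply: continuous_det => k l; under eq_fun do rewrite !mxE.
  exact: cM.
under eq_fun do rewrite mxE.
have : continuous
    (cst ((-1) ^+ (j + i)) \* fun z => \det (row' j (col' i (M z)))).
  by move=> z; apply: continuousM; [exact: cst_continuous | exact: cdet].
by [].
Qed.

Lemma coord_cont_cramer_ls (T : topologicalType) (R : numFieldType) (m r : nat)
  (B : T -> 'M[R]_(m, r)) (b : T -> 'cV[R]_m) :
  coord_cont B -> coord_cont b -> coord_cont (fun z => cramer_ls (B z) (b z)).
Proof.
move=> cB cb; have cBT := coord_cont_trmx cB.
apply: coord_cont_mulmx; last exact: coord_cont_mulmx.
by apply: coord_cont_adj; exact: coord_cont_mulmx.
Qed.

(** * Nonvanishing sets of polynomial functions *)

Lemma map_cramer_ls (R S : comPzRingType) (f : {rmorphism R -> S}) (m r : nat)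
  (B : 'M[R]_(m, r)) (b : 'cV[R]_m) :
  map_mx f (cramer_ls B b) = cramer_ls (map_mx f B) (map_mx f b).
Proof. by rewrite /cramer_ls !map_mxM map_mx_adj !map_mxM map_trmx. Qed.

(** If U contains the ball of radius e around 0, it contains the infinitely many
    distinct numbers e / (k + 2), and P has finitely many roots. *)
Lemma exists_small_nonroot (R : realFieldType) (P : {poly R}) (U : set R) :
  P != 0 -> nbhs 0 U -> exists2 t, U t & P.[t] != 0.
Proof.
move=> P0 /nbhs_ballP[e /= e0 eU].
pose rs := [seq e / k.+2%:R | k <- iota 0 (size P)].
have rsU : uniq rs.
  rewrite map_inj_uniq ?iota_uniq // => k l.
  move=> /(mulfI (lt0r_neq0 e0)) /invr_inj /eqP.
  by rewrite eqr_nat => /eqP[].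
have : ~~ all (root P) rs.
  apply/negP => /(max_poly_roots P0) /(_ rsU).
  by rewrite size_map size_iota ltnn.
case/allPn => t /mapP[k _ ->] tP; exists (e / k.+2%:R) => //.
apply: eU; rewrite /ball /= sub0r normrN ger0_norm ?divr_ge0 ?ltW //.
by rewrite ltr_pdivrMr // ltr_pMr // ltr1n.
Qed.

(** On the line from p to a point q where f does not vanish, f is a nonzero
    polynomial in the parameter, hence is nonzero at points arbitrarily close
    to p. *)
Lemma dense_polynomial_neq0 (R : realFieldType) (V : normedModType R)
  (f : V -> R) :
  (forall p v, exists P : {poly R}, forall t, f (p + t *: v) = P.[t]) ->
  (exists q, f q != 0) -> dense [set p | f p != 0]%classic.
Proof.
(* at t = 1 the line through p with direction q - p reaches q *)
move=> polyf [q fq] O [p Op] oO.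
have [P PE] := polyf p (q - p).
have P0 : P != 0.
  apply: contraNneq fq => P0; have := PE 1.
  by rewrite scale1r addrC subrK P0 horner0 => ->.
have line_cont : continuous (fun t : R => p + t *: (q - p)).
  move=> t; apply: cvgD; first exact: cvg_cst.
  by apply: cvgZr_tmp; exact: cvg_id.
have O0 : nbhs (0 : R) ((fun t : R => p + t *: (q - p)) @^-1` O)%classic.
  apply: line_cont; rewrite scale0r addr0; exact: open_nbhs_nbhs.
have [t Ot Pt] := exists_small_nonroot P0 O0.
by exists (p + t *: (q - p)); split=> //=; rewrite PE.
Qed.

Lemma open_dense_forall (T : topologicalType) (I : finType) (P : pred I)
  (D : I -> set T) : (forall i, P i -> open (D i) /\ dense (D i)) ->
  open [set x | forall i, P i -> D i x]%classic /\
  dense [set x | forall i, P i -> D i x]%classic.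
Proof.
move=> odD.
have -> : [set x | forall i, P i -> D i x]%classic =
          (\big[setI/setT]_(i | P i) D i)%classic.
  rewrite -bigcap_seq_cond; apply/seteqP; split=> x /= h i.
    by move=> /andP[_]; exact: h.
  by move=> Pi; apply: h => /=; rewrite mem_index_enum.
apply: (big_ind (fun S : set T => open S /\ dense S)) => //.
- by split; [exact: openT | move=> O O0 _; rewrite setIT].
- by move=> S S' [oS dS] [oS' dS']; split; [exact: openI | exact: denseI].
Qed.

(** The Cramer vector of data over the polynomial ring, specialised at t: the
    construction commutes with ring morphisms, in particular with evaluation. *)
Lemma cramer_ls_line (R : realType) (m n : nat) (J : {set 'I_n})
  (k : 'I_#|J|) (p v : 'M[R]_(m, n) * 'cV[R]_m) :
  exists P : {poly R}, forall t,
    cramer_ls (subcols (p + t *: v).1 J) (p + t *: v).2 k ord0 = P.[t].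
Proof.
pose line r c (M N : 'M[R]_(r, c)) := map_mx polyC M + 'X *: map_mx polyC N.
have lineE r c (M N : 'M[R]_(r, c)) t :
    map_mx (horner_eval t) (line r c M N) = M + t *: N.
  by apply/matrixP => i j; rewrite !mxE /horner_eval !hornerE.
pose c := cramer_ls (colsub (enum_val (A:=mem J)) (line _ _ p.1 v.1))
  (line _ _ p.2 v.2).
exists (c k ord0) => t.
transitivity (map_mx (horner_eval t) c k ord0); last by rewrite mxE.
by rewrite map_cramer_ls map_mxsub !lineE.
Qed.

(** If A_J consists of the first standard basis vectors, then the Gram matrix is
    the identity and the Cramer vector is the beginning of b. *)
Lemma cramer_ls_witness (R : realType) (m n : nat) (J : {set 'I_n})
  (k : 'I_#|J|) : (#|J| <= m)%N ->
  exists q : 'M[R]_(m, n) * 'cV[R]_m,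
    cramer_ls (subcols q.1 J) q.2 k ord0 != 0.
Proof.
move=> Jm.
exists (\matrix_(i, j) (i == index j (enum J) :> nat)%:R, const_mx 1) => /=.
set B := subcols _ J.
have -> : B = pid_mx #|J|.
  apply/matrixP => i l; rewrite !mxE.
  rewrite /enum_val index_uniq -?cardE ?enum_uniq //.
  by case: eqP => // ->; rewrite ltn_ord.
rewrite /cramer_ls tr_pid_mx mul_pid_mx minnn (minn_idPr Jm) pid_mx_1 adj1.
rewrite mul1mx mxE (bigD1 (widen_ord Jm k)) //= big1 => [|i ik].
  by rewrite !mxE /= eqxx ltn_ord mulr1 addr0 oner_eq0.
by rewrite !mxE eq_sym [_ == _](negbTE ik) mul0r.
Qed.

Theorem theorem2 (R : realType) (m n s : nat)
  (hsn : (s < n)%N) (hsm : (s <= m)%N) :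
  open (@nondegenerate_data R m n s) /\ dense (@nondegenerate_data R m n s).
Proof.
have -> : @nondegenerate_data R m n s =
    [set Ab | forall i : {J : {set 'I_n} & 'I_#|J|}, (#|tag i| <= s)%N ->
       cramer_ls (subcols Ab.1 (tag i)) Ab.2 (tagged i) ord0 != 0]%classic.
  apply/seteqP; split=> -[A b] /=.
    by move=> /nondegenerate_dataP h [J k] /h /ls_fullP /(_ k).
  move=> h; apply/nondegenerate_dataP => J Js; apply/ls_fullP => k.
  exact: (h (Tagged _ k)).
apply: open_dense_forall => -[J k] /= Js; split.
  apply: (@open_comp _ _
    (fun Ab => cramer_ls (subcols Ab.1 J) Ab.2 k ord0) [set t | t != 0]%classic);
    last exact: open_neq.
  move=> Ab _; apply: coord_cont_cramer_ls => [|i j {}Ab].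
    apply: coord_cont_mxsub => i j {}Ab.
    apply: (@continuous_comp _ _ _ fst (fun A : 'M[R]_(m, n) => A i j)).
      exact: cvg_fst.
    exact: coord_continuous.
  apply: (@continuous_comp _ _ _ snd (fun b : 'cV[R]_m => b i j)).
    exact: cvg_snd.
  exact: coord_continuous.
apply: dense_polynomial_neq0; first exact: cramer_ls_line.
by apply: cramer_ls_witness; exact: leq_trans Js hsm.
Qed.
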